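(* Let $G=G[X,Y]$ be a bipartite graph with $n$ vertices and $m$ edges and with bipartition $(X,Y)$, where $|X|=r$, $|Y|=s$, $1\le r\leq s$ (so $n=r+s$) and $m\leq\frac{1}{2}rs$. Then $$0\leq \kappa'(G)\,\kappa'(G^{bc})\leq M(n,m),$$ where $$M(n,m)=\begin{cases} 0, & \text{if } m\leq n-2,\ \text{or } (m=n-1 \text{ and } r=1),\\ \frac{m}{s}\left(r-\frac{m}{s}\right), & \text{if } m\equiv 0\ (\mathrm{mod}\ s) \text{ and } m\geq n,\\ \left\lfloor\frac{m}{s}\right\rfloor\left(r-1-\left\lfloor\frac{m}{s}\right\rfloor\right), & \text{otherwise.}\end{cases}$$ Furthermore, these bounds are best possible for all $n$ and $m$: for all integers $r,s,m$ with $1\le r\le s$ and $0\le m\le \frac12 rs$, and $n=r+s$, there is a bipartite graph $G[X,Y]$ with $|X|=r$, $|Y|=s$ and $m$ edges for which the lower bound holds with equality, and there is such a graph for which the upper bound holds with equality.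
   Context: All graphs are finite and simple. $G=G[X,Y]$ denotes a bipartite graph with a specified bipartition $(X,Y)$: every edge joins a vertex of $X$ to a vertex of $Y$. Its bipartite complementary graph $G^{bc}$ is the bipartite graph with $V(G^{bc})=V(G)$, the same bipartition $(X,Y)$, and $E(G^{bc})=\{xy: x\in X,\ y\in Y,\ xy\notin E(G)\}$. The edge-connectivity $\kappa'(H)$ of a graph $H$ with at least two vertices is the minimum size of an edge set $F\subseteq E(H)$ such that $H-F$ is disconnected (so $\kappa'(H)=0$ if $H$ is disconnected). The quantity $M(n,m)$ depends on $r$ and $s$ as well. *)

(* Defs.v *)
From mathcomp Require Import all_boot all_order all_algebra.

Set Implicit Arguments.
Unset Strict Implicit.
Unset Printing Implicit Defensive.

Import Order.TTheory GRing.Theory Num.Theory.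

Section EdgeConnectivity.

(* A graph on the vertex type V is given by its edge set E : {set {set V}},
   an edge being the pair of its ends. *)
Variables (V : finType) (E : {set {set V}}).

Definition adjacent : rel V := fun u v => [set u; v] \in E.

Definition connected : bool := [forall u, forall v, connect adjacent u v].

End EdgeConnectivity.

Definition edge_cut (V : finType) (E F : {set {set V}}) : bool :=
  (F \subset E) && ~~ connected (E :\: F).

(* E itself is an edge cut as soon as V has two vertices (edge_cut_all), so
   the default value of [arg min] is then a legitimate competitor; for #|V| <= 1
   there is no edge cut and the value below is meaningless. *)
Definition edge_connectivity (V : finType) (E : {set {set V}}) : nat :=
  #|[arg min_(F < E | edge_cut E F) #|F| ]|.

Lemma edge_cut_all (V : finType) (E : {set {set V}}) :
  1 < #|V| -> edge_cut E E.
Proof.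
move=> /card_gt1P[u [v [_ _ uv]]]; rewrite /edge_cut subxx /= setDv.
apply/forallPn; exists u; apply/forallPn; exists v.
apply/connectP => -[[|w p] /=]; first by move=> _ vu; rewrite vu eqxx in uv.
by rewrite /adjacent inE.
Qed.

Lemma edge_connectivityP (V : finType) (E : {set {set V}}) : 1 < #|V| ->
  (exists2 F, edge_cut E F & #|F| = edge_connectivity E) /\
  (forall F, edge_cut E F -> edge_connectivity E <= #|F|).
Proof.
move=> V2; rewrite /edge_connectivity.
case: arg_minnP => [|F cutF minF]; first exact: edge_cut_all.
by split=> //; exists F.
Qed.

Record bipartite_graph (V : finType) := BipartiteGraph {
  xpart : {set V};
  ypart : {set V};
  edges : {set {set V}};
  bipartite_cover : xpart :|: ypart = [set: V];
  bipartite_disjoint : [disjoint xpart & ypart];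
  bipartite_edges : forall e, e \in edges ->
    exists x y, [/\ x \in xpart, y \in ypart & e = [set x; y]]
}.

Lemma edge_card2 (V : finType) (G : bipartite_graph V) (e : {set V}) :
  e \in edges G -> #|e| = 2.
Proof.
move=> /bipartite_edges[x [y [xX yY ->]]]; rewrite cards2.
by case: eqP => // xy; have := disjointFr (bipartite_disjoint G) xX; rewrite xy yY.
Qed.

Definition bc_edges (V : finType) (G : bipartite_graph V) : {set {set V}} :=
  [set [set x; y] | x in xpart G, y in ypart G & [set x; y] \notin edges G].

Fact bc_edgesP (V : finType) (G : bipartite_graph V) (e : {set V}) :
  e \in bc_edges G ->
  exists x y, [/\ x \in xpart G, y \in ypart G & e = [set x; y]].
Proof. by case/imset2P=> x y xX; rewrite inE => /andP[yY _] ->; exists x, y. Qed.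

Definition bipartite_complement (V : finType) (G : bipartite_graph V) :
    bipartite_graph V :=
  BipartiteGraph (bipartite_cover G) (bipartite_disjoint G) (@bc_edgesP V G).

Definition kappa_product (V : finType) (G : bipartite_graph V) : nat :=
  edge_connectivity (edges G) * edge_connectivity (edges (bipartite_complement G)).

Definition has_parameters (r s m : nat) (V : finType) (G : bipartite_graph V) :
    Prop :=
  [/\ #|xpart G| = r, #|ypart G| = s & #|edges G| = m].

(* The differences in the last two cases are taken in rat, where they are not
   truncated; n - 2 and n - 1 are natural-number differences, harmless since
   n = r + s >= 2. For natural numbers, m %/ s is the floor of m / s. *)
Definition M (r s n m : nat) : rat :=
  if (m <= n - 2) || ((m == n - 1) && (r == 1)) then 0%R
  else if (s %| m) && (n <= m) then (m%:R / s%:R * (r%:R - m%:R / s%:R))%R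
  else ((m %/ s)%:R * (r%:R - 1 - (m %/ s)%:R))%R.

(* Main.v *)
(* Upper bound: the edges at a vertex y of Y form a cut, so the edge-connectivity
   is at most the average degree of Y, both in G and in its complement; and a
   connected graph has at least n - 1 edges.

   Sharpness: write m = d s + e with e < s and join y to d or d + 1 cyclically
   consecutive rows starting at y modulo r. The trace A on X of a cut is either
   trivial, and then a full vertex star of Y is cut, or it separates some
   consecutive rows x, x + 1. Among the cyclic intervals of length l >= 2, the
   l - 1 that contain both x and x + 1 meet A and its complement, and at least one
   more does, since otherwise sliding an interval from x + 1 around to x would
   never leave the complement of A. So at least l edges are cut. The complement
   of the graph has the same shape. Length 1 only occurs for d = 1 and for the
   complement when r = 3, and then only connectedness is at stake. *)

Require Import Defs.
From mathcomp Require Import all_boot all_order all_algebra.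
From mathcomp Require Import zify.

Set Implicit Arguments.
Unset Strict Implicit.
Unset Printing Implicit Defensive.

Import Order.TTheory GRing.Theory Num.Theory.

(** * Connectedness through vertex sets and their boundaries *)

Section Connectivity.

Variables (V : finType) (E : {set {set V}}).

(** If no edge left [C], then [C] would be closed under adjacency, hence under [connect]. *)
Lemma connected_crossing (C : {set V}) (u v : V) :
  connected E -> u \in C -> v \notin C ->
  exists a b, [/\ a \in C, b \notin C & [set a; b] \in E].
Proof.
move=> /forallP/(_ u)/forallP/(_ v) uv uC vC.
case: (boolP [exists a in C, exists b in ~: C, [set a; b] \in E]).
  case/exists_inP => a aC /exists_inP[b]; rewrite inE => bC abE.
  by exists a, b.
move=> noE; have clC : closed (adjacent E) C.
  move=> a b abE; apply/idP/idP => [aC|bC]; apply: contraNT noE => nC.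
    by apply/exists_inP; exists a => //; apply/exists_inP; exists b; rewrite ?inE.
  apply/exists_inP; exists b => //; apply/exists_inP; exists a; rewrite ?inE //.
  by rewrite setUC.
by have := closed_connect clC uv; rewrite uC (negPf vC).
Qed.

Lemma not_connectedP :
  reflect (exists (C : {set V}) u v, [/\ u \in C, v \notin C &
             forall a b, a \in C -> b \notin C -> [set a; b] \notin E])
          (~~ connected E).
Proof.
apply: (iffP idP) => [|[C [u [v [uC vC noE]]]]]; last first.
  apply/negP => /connected_crossing/(_ uC vC)[a [b [aC bC]]].
  by apply/negP/noE.
case/forallPn => u /forallPn[v nuv].
exists [set w | connect (adjacent E) u w], u, v.
rewrite !inE connect0 nuv; split=> // a b; rewrite !inE => ua; apply: contra => ab.
by apply: connect_trans ua (connect1 _).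
Qed.

(** Grow a vertex set from a single vertex: connectedness supplies an edge leaving it, and adding
    the far end of that edge brings at least one new inner edge. *)
Lemma connected_card_edges : connected E -> #|V| <= #|E|.+1.
Proof.
move=> conE.
have grow k : 0 < k <= #|V| ->
    exists2 C : {set V}, #|C| = k & k <= #|[set e in E | e \subset C]|.+1.
  elim: k => [|[|k] IHk] //= kV.
    by case/card_gt0P: kV => v _; exists [set v]; rewrite ?cards1.
  have [C cC leC] := IHk (ltnW kV).
  have /card_gt0P[u uC] : 0 < #|C| by rewrite cC.
  have /card_gt0P[v] : 0 < #|~: C| by rewrite cardsCs setCK cC subn_gt0.
  rewrite inE => vC; have [a [b [aC bC abE]]] := connected_crossing conE uC vC.
  exists (b |: C); first by rewrite cardsU1 bC cC.
  apply: (leq_ltn_trans leC); rewrite ltnS; apply/proper_card/properP; split.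
    apply/subsetP => e; rewrite !inE => /andP[-> /= /subset_trans]; apply.
    exact: subsetUr.
  exists [set a; b]; first by rewrite inE abE subUset !sub1set !inE aC eqxx orbT.
  by rewrite inE abE subUset !sub1set (negPf bC) andbF.
case: (posnP #|V|) => [->|V0] //.
have [|C _ /leq_trans] := grow #|V|; first by rewrite V0 leqnn.
by apply; rewrite ltnS subset_leq_card // setIdE subsetIl.
Qed.

End Connectivity.

(** * Bounds on edge-connectivity from boundaries and degrees *)

Section EdgeConnectivityBounds.

Variables (V : finType) (E : {set {set V}}).
Hypothesis V2 : 1 < #|V|.

(** Removing a minimum cut disconnects the graph, so the cut contains every boundary edge of some
    proper nonempty vertex set. *)
Lemma edge_connectivity_lower (k : nat) :
  (forall (C : {set V}) u v, u \in C -> v \notin C ->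
     k <= #|[set e in E | [exists a in C, exists b in ~: C, e == [set a; b]]]|) ->
  k <= edge_connectivity E.
Proof.
move=> kC; have [[F /andP[_ /not_connectedP[C [u [v [uC vC noE]]]]] <-] _] :=
  @edge_connectivityP V E V2.
apply: leq_trans (kC C u v uC vC) _; apply/subset_leq_card/subsetP => e.
rewrite inE => /andP[eE /exists_inP[a aC /exists_inP[b]]].
rewrite inE => bC /eqP def_e; have := noE a b aC bC.
by rewrite -def_e inE eE andbT negbK.
Qed.

Lemma edge_connectivity_degree (y : V) :
  edge_connectivity E <= #|[set e in E | y \in e]|.
Proof.
have [_ minE] := @edge_connectivityP V E V2; apply: minE.
apply/andP; split; first by rewrite setIdE subsetIl.
have /card_gt0P[v] : 0 < #|[set~ y]| by rewrite cardsC1; case: #|V| V2 => [|[]].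
rewrite !inE => vy.
apply/not_connectedP; exists [set y], y, v; rewrite !inE eqxx vy; split=> // a b.
by rewrite !inE => /eqP-> _; rewrite eqxx /= andbT andNb.
Qed.

Lemma edge_connectivity_eq0 : ~~ connected E -> edge_connectivity E = 0.
Proof.
move=> nE; have [_ minE] := @edge_connectivityP V E V2.
apply/eqP; rewrite -leqn0 -(cards0 {set V}); apply: minE.
by rewrite /edge_cut sub0set setD0.
Qed.

End EdgeConnectivityBounds.

(** * Counting edges in a bipartite graph and its complement *)

Section Bounds.

Variables (V : finType) (G : bipartite_graph V).

(** The star of a vertex is a cut, so every degree is at least the edge-connectivity; each edge has
    one end in Y, so the degrees over Y sum to the number of edges. *)
Lemma card_ypart_edge_connectivity :
  1 < #|V| -> #|ypart G| * edge_connectivity (edges G) <= #|edges G|.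
Proof.
move=> V2; rewrite -sum_nat_const.
apply: (@leq_trans (\sum_(y in ypart G) #|[set e in edges G | y \in e]|)).
  by apply: leq_sum => y _; apply: edge_connectivity_degree.
under eq_bigr => y _.
  rewrite -sum1_card; under eq_bigl => e do rewrite inE.
  rewrite big_mkcondr /=; over.
rewrite exchange_big -sum1_card /=; apply: leq_sum => e /bipartite_edges.
case=> x [y [xX yY ->]].
rewrite -big_mkcondr sum1_card.
rewrite -(cards1 y); apply/subset_leq_card/subsetP => z.
rewrite unfold_in /= !inE => /andP[zY /orP[/eqP zx|//]].
by have := disjointFr (bipartite_disjoint G) xX; rewrite -zx zY.
Qed.

Lemma card_bc_edges :
  #|edges G| + #|edges (bipartite_complement G)| = #|xpart G| * #|ypart G|.
Proof.
rewrite -cardsX.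
have XY x : x \in xpart G -> x \in ypart G -> False.
  by move=> xX; rewrite (disjointFr (bipartite_disjoint G) xX).
rewrite -(@card_in_imset _ _ (fun p : V * V => [set p.1; p.2])
            (setX (xpart G) (ypart G))); last first.
  move=> [x y] [x' y'] /setXP[xX yY] /setXP[x'X y'Y] /= eqxy.
  have : x \in [set x'; y'] by rewrite -eqxy set21.
  have : y \in [set x'; y'] by rewrite -eqxy set22.
  rewrite !inE => /orP[/eqP yx'|/eqP->].
    by case: (XY x'); rewrite // -yx'.
  by case/orP => /eqP xE; rewrite ?xE //; case: (XY x); rewrite // xE.
rewrite -cardsUI.
have -> : edges G :&: edges (bipartite_complement G) = set0.
  apply/setP => e; rewrite !inE; apply/andP => -[eG].
  by case/imset2P => x y _; rewrite inE => /andP[_ /negP nG] eE; rewrite -eE in nG.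
rewrite cards0 addn0; apply: eq_card => e; rewrite !inE.
apply/idP/imsetP => [/orP[/bipartite_edges|/bc_edgesP] [x [y [xX yY ->]]]|].
- by exists (x, y); rewrite // inE xX.
- by exists (x, y); rewrite // inE xX.
case=> -[x y] /setXP[xX yY] ->; case: (boolP (_ \in edges G)) => //= nG.
by apply/imset2P; exists x y; rewrite // inE yY.
Qed.

End Bounds.

(** * Bipartite graphs given by relations *)

Section RelGraph.

Variables (S T : finType) (R : S -> T -> bool).

Definition rel_edge (p : S * T) : {set S + T} := [set inl p.1; inr p.2].

Lemma rel_edge_inj : injective rel_edge.
Proof.
move=> [x y] [x' y'] /setP eqE; congr pair.
  by have := eqE (inl x); rewrite !inE eqxx /= orbF => /esym/eqP[].
by have := eqE (inr y); rewrite !inE eqxx /= => /esym/eqP[].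
Qed.

Definition rel_edges : {set {set S + T}} :=
  rel_edge @: [set p | R p.1 p.2].

Lemma mem_rel_edges x y : (rel_edge (x, y) \in rel_edges) = R x y.
Proof. by rewrite mem_imset ?inE //; apply: rel_edge_inj. Qed.

Fact rel_cover :
  [set inl x | x : S] :|: [set inr y | y : T] = [set: S + T].
Proof.
apply/setP => -[x|y]; rewrite !inE; apply/orP; [left|right]; exact: imset_f.
Qed.

Fact rel_disjoint : [disjoint [set inl x | x : S] & [set (inr y : S + T) | y : T]].
Proof.
rewrite -setI_eq0; apply/eqP/setP => v; rewrite !inE; apply/andP.
by case=> /imsetP[x _ ->] /imsetP[].
Qed.

Fact rel_edgesP (e : {set S + T}) : e \in rel_edges -> exists x y,
  [/\ x \in [set inl x | x : S], y \in [set inr y | y : T] & e = [set x; y]].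
Proof.
by case/imsetP => -[x y] _ ->; exists (inl x), (inr y); rewrite !imset_f.
Qed.

Definition rel_graph : bipartite_graph (S + T)%type :=
  BipartiteGraph rel_cover rel_disjoint rel_edgesP.

Lemma card_rel_edges : #|rel_edges| = \sum_y #|[set x | R x y]|.
Proof.
rewrite card_imset; last exact: rel_edge_inj.
rewrite -sum1_card; under eq_bigl => p do rewrite inE.
rewrite -(pair_big_dep xpredT R (fun _ _ => 1)) /= (exchange_big_dep xpredT) //=.
by apply: eq_bigr => y _; rewrite sum1_card cardsE.
Qed.

Lemma rel_graph_parameters :
  has_parameters #|S| #|T| #|rel_edges| rel_graph.
Proof. by split=> //; rewrite card_imset // => x x' []. Qed.

(* Once the trace [A] of a cut on [S] is fixed, a vertex [y] with neighbours on
   both sides of [A] contributes to the cut whichever side it is placed on. *)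
Definition split_by (A : {set S}) : {set T} :=
  [set y | [exists x in A, R x y] && [exists x in ~: A, R x y]].

(** If the trace of a cut on [S] is empty or everything, some vertex of [T] lies opposite to all of
    [S] and its whole star is cut. Otherwise each vertex of [split_by A] gives a cut edge of its
    own. *)
Lemma rel_edge_connectivity_lower (k : nat) : 1 < #|S| + #|T| ->
  (forall y, k <= #|[set x | R x y]|) ->
  (forall A, A != set0 -> ~: A != set0 -> k <= #|split_by A|) ->
  k <= edge_connectivity rel_edges.
Proof.
move=> V2 degk splitk; apply: edge_connectivity_lower; first by rewrite card_sum.
move=> C u v uC vC; set B := [set e in _ | _].
have in_B x y : R x y -> (inl x \in C) != (inr y \in C) -> rel_edge (x, y) \in B.
  move=> Rxy; rewrite inE mem_rel_edges Rxy /=.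
  case: (boolP (inl x \in C)) => xC; case: (boolP (inr y \in C)) => yC //= _.
    apply/exists_inP; exists (inl x) => //.
    by apply/exists_inP; exists (inr y); rewrite ?inE.
  apply/exists_inP; exists (inr y) => //.
  apply/exists_inP; exists (inl x); rewrite ?inE //.
  by rewrite /rel_edge setUC.
pose A := [set x | inl x \in C].
have star y : (forall x, (inl x \in C) != (inr y \in C)) -> k <= #|B|.
  move=> xy; apply: leq_trans (degk y) _.
  rewrite -(@card_imset _ _ (fun x => rel_edge (x, y))); last first.
    by move=> x x' /rel_edge_inj[].
  apply/subset_leq_card/subsetP => e /imsetP[x]; rewrite inE => Rxy ->.
  exact: in_B.
case: (eqVneq A set0) => [A0|An0].
  have xA x : inl x \in C = false by have /setP/(_ x) := A0; rewrite !inE.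
  case: u uC => [x|y yC]; first by rewrite xA.
  by apply: (star y) => x; rewrite xA yC.
case: (eqVneq (~: A) set0) => [A0|An1].
  have xA x : inl x \in C by have /setP/(_ x) := A0; rewrite !inE => /negbFE.
  case: v vC => [x|y yC]; first by rewrite xA.
  by apply: (star y) => x; rewrite xA (negPf yC).
apply: leq_trans (splitk A An0 An1) _.
(* [g y] is a neighbour of [y] across the cut; the default [u] never occurs for [y] in
   [split_by A]. *)
pose g y := odflt u (omap inl [pick x | R x y && ((inl x \in C) != (inr y \in C))]).
have gP y : y \in split_by A ->
    exists2 x, g y = inl x & R x y && ((inl x \in C) != (inr y \in C)).
  rewrite inE => /andP[/exists_inP[x1 x1A R1] /exists_inP[x2 x2A R2]].
  rewrite /g; case: pickP => [x xP|no]; first by exists x.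
  move: x1A x2A (no x1) (no x2); rewrite !inE R1 R2 => -> /negPf->.
  by case: (inr y \in C).
rewrite -(@card_in_imset _ _ (fun y => [set g y; inr y])).
  apply/subset_leq_card/subsetP => e /imsetP[y /gP[x gx /andP[Rxy xy]] ->].
  by rewrite gx; apply: in_B.
move=> y y' /gP[x -> _] /gP[x' -> _] eqE.
by have [] := rel_edge_inj (eqE : rel_edge (x, y) = rel_edge (x', y')).
Qed.

End RelGraph.

Lemma bc_edges_rel_graph (S T : finType) (R : S -> T -> bool) :
  bc_edges (rel_graph R) = rel_edges (fun x y => ~~ R x y).
Proof.
apply/setP => e; apply/imset2P/imsetP => [[_ y0 /imsetP[x _ ->]]|[[x y]]].
  rewrite inE => /andP[/imsetP[y _ ->]]; rewrite -/(rel_edge (x, y)).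
  by rewrite mem_rel_edges => nR ->; exists (x, y); rewrite // inE.
rewrite inE /= => nR ->; exists (inl x) (inr y); rewrite ?imset_f //.
by rewrite inE imset_f //= -/(rel_edge (x, y)) mem_rel_edges.
Qed.

(** * Cyclic intervals and the sets they split *)

Section Cyclic.

Variable p : nat.
Implicit Types (x j : 'I_p.+1) (A : {set 'I_p.+1}).

Lemma inZpD (a b : nat) : inZp (a + b) = (inZp a + inZp b)%R :> 'I_p.+1.
Proof. by apply: val_inj; rewrite /= modnDml modnDmr. Qed.

(** A set closed under adding 1 would contain all residues as soon as it contains one. *)
Lemma cyclic_exit A : A != set0 -> ~: A != set0 ->
  exists2 x, x \in A & (x + inZp 1)%R \notin A.
Proof.
case/set0Pn => x xA /set0Pn[z]; rewrite inE => zA.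
case: (boolP [exists x in A, (x + inZp 1)%R \notin A]) => [/exists_inP//|].
move=> /exists_inPn step; case/negP: zA.
have walk k : (x + inZp k)%R \in A.
  elim: k => [|k IHk]; first by rewrite (_ : inZp 0 = 0%R) ?addr0 //; apply: val_inj.
  by have := step _ IHk; rewrite negbK -addrA -inZpD addn1.
by have := walk (z - x)%R; rewrite valZpK addrC subrK.
Qed.

Lemma card_cyclic_interval (c : 'I_p.+1) (k : nat) : k <= p.+1 ->
  #|[set x | (x - c)%R < k]| = k.
Proof.
move=> kp.
have -> : [set x | (x - c)%R < k] =
    [set (widen_ord kp i + c)%R | i : 'I_k].
  apply/setP => x; rewrite inE; apply/idP/imsetP => [xk|[i _ ->]]; last first.
    by rewrite addrK /=.
  exists (Ordinal xk) => //; rewrite -[LHS](subrK c); congr (_ + _)%R.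
  exact: val_inj.
rewrite card_imset ?card_ord // => i i' /addIr/(congr1 val) /= ii'.
exact: val_inj.
Qed.

Variables (T : finType) (R : 'I_p.+1 -> T -> bool).

Lemma split_by_cyclic_intervals (l : nat) (col : 'I_p.+1 -> T) A :
  1 < l <= p.+1 -> injective col ->
  (forall x j, (x - j)%R < l -> R x (col j)) ->
  A != set0 -> ~: A != set0 -> l <= #|split_by R A|.
Proof.
move=> /andP[l1 lp] col_inj Rcol A0 A1.
pose mixed j := col j \in split_by R A.
have mixedP j x y : (x - j)%R < l -> (y - j)%R < l -> x \in A -> y \notin A ->
    mixed j.
  move=> /Rcol Rx /Rcol Ry xA yA; rewrite /mixed inE; apply/andP.
  by split; apply/exists_inP; [exists x | exists y; rewrite ?inE].
have [x xA x1A] := cyclic_exit A0 A1.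
have mixed_back (t : nat) : t < l.-1 -> mixed (x - inZp t)%R.
  move=> tl; apply: (mixedP _ x (x + inZp 1)%R) => //.
    by rewrite subKr /= modn_small; lia.
  have -> : (x + inZp 1 - (x - inZp t) = inZp t.+1)%R.
    by rewrite -[t.+1]addn1 inZpD opprB [LHS]addrC addrA subrK.
  by rewrite /= modn_small; lia.
(* These [x + k] are exactly the starts other than the [l - 1] starts [x - t] above. The last of
   them is [x - (l - 1)], whose interval ends at [x]. *)
have [k /andP[k0 kl] mixedk] : exists2 k, 0 < k <= p.+1 - l.-1 & mixed (x + inZp k)%R.
  case: (boolP [exists k : 'I_(p.+1 - l.-1), mixed (x + inZp k.+1)%R]).
    by case/existsP => k; exists k.+1; rewrite //=.
  move=> /existsPn none.
  (* An unmixed interval that starts outside [A] has its second element outside [A] too, because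
     [1 < l]. *)
  have walk k : k < p.+1 - l.-1 -> (x + inZp k.+1)%R \notin A.
    elim: k => [|k IHk] // kl; have := none (Ordinal (ltnW kl)).
    apply: contra => /= kA; apply: (mixedP _ _ _ _ _ kA (IHk (ltnW kl))).
      have -> : (x + inZp k.+2 - (x + inZp k.+1) = inZp 1)%R.
        by rewrite -(addn1 k.+1) inZpD addrA [LHS]addrC addKr.
      by rewrite /= modn_small; lia.
    by rewrite subrr /=; lia.
  exists (p.+1 - l.-1); first by lia.
  have last_out : (x + inZp (p.+1 - l.-1))%R \notin A.
    by have := walk (p.+1 - l.-1).-1; rewrite prednK; [apply; lia | lia].
  apply: (mixedP _ _ _ _ _ xA last_out); last by rewrite subrr /=; lia.
  have -> : (x - (x + inZp (p.+1 - l.-1)) = inZp l.-1)%R.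
    apply/eqP; rewrite opprD addrA subrr sub0r eqr_oppLR -addr_eq0 -inZpD.
    by apply/eqP/val_inj; rewrite /= subnK ?modnn; lia.
  by rewrite /= modn_small; lia.
pose f (t : 'I_l.-1) := (x - inZp t)%R.
have f_inj : injective f.
  move=> t t' /addrI/oppr_inj/(congr1 val) /=.
  have := ltn_ord t; have := ltn_ord t' => lt' lt; rewrite !modn_small; [|lia|lia].
  by move=> tt'; apply: val_inj.
have kf : (x + inZp k)%R \notin f @: setT.
  apply/imsetP => -[t _ /addrI /eqP].
  rewrite -addr_eq0 -inZpD => /eqP/(congr1 val) /=.
  by have lt := ltn_ord t; rewrite modn_small; lia.
have <- : #|col @: ((x + inZp k)%R |: f @: setT)| = l.
  rewrite card_imset // cardsU1 kf card_imset // cardsT card_ord; lia.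
apply/subset_leq_card/subsetP => _ /imsetP[j jP ->].
by case/setU1P: jP => [->|/imsetP[t _ ->]] //; apply: mixed_back.
Qed.

(** Around the cycle there is a step leaving [A] and a different step entering it; at most one of
    them is the step at [j0], and the other has both its ends in a common column. *)
Lemma split_by_cyclic_edges (j0 : 'I_p.+1) A :
  (forall j, j != j0 -> exists2 y, R j y & R (j + inZp 1)%R y) ->
  A != set0 -> ~: A != set0 -> 0 < #|split_by R A|.
Proof.
move=> Rj A0 A1.
have [x xA x1A] := cyclic_exit A0 A1.
have [|z zA z1A] := cyclic_exit A1; first by rewrite setCK.
move: zA z1A; rewrite !inE negbK => zA z1A; apply/card_gt0P.
case: (eqVneq x j0) => [xj|/Rj[y Rx Rx1]].
  have /Rj[y Rz Rz1] : z != j0 by rewrite -xj; apply: contraNneq zA => ->.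
  exists y; rewrite inE; apply/andP; split; apply/exists_inP.
    by exists (z + inZp 1)%R.
  by exists z; rewrite ?inE.
exists y; rewrite inE; apply/andP; split; apply/exists_inP; first by exists x.
by exists (x + inZp 1)%R; rewrite ?inE.
Qed.

End Cyclic.

(* The longer columns come first: this is what makes both the [r - 1] first
   columns ([d = 1]) and the last two complementary ones ([r = 3]) overlap. *)
Definition band (p s d e : nat) (x : 'I_p.+1) (y : 'I_s) : bool :=
  (x - inZp y)%R < d + (y < e).

(** A column [y >= e] has length 1, so its complement in three rows is the pair [y + 1], [y + 2].
    The columns [s - 1] and [s - 2] are of this kind and give the steps at [s] and [s - 1], which
    are all but the one at [s + 1] modulo 3. *)
Lemma split_by_band3_complement (p s e : nat) (A : {set 'I_p.+1}) :
  p = 2 -> 1 < e -> 2 * e <= s -> A != set0 -> ~: A != set0 ->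
  0 < #|split_by (fun x y => ~~ @band p s 1 e x y) A|.
Proof.
move=> p2; move: A; rewrite p2 => A e1 es.
apply: (split_by_cyclic_edges (j0 := inZp s.+1)) => j jN.
have step (y : 'I_s) : e <= y -> j = inZp y.+1 ->
    ~~ band 1 e j y && ~~ band 1 e (j + inZp 1)%R y.
  move=> ey ->; rewrite /band (ltnNge y) ey addn0 -[y.+1]addn1 inZpD.
  by rewrite [(inZp y + _)%R]addrC addrK addrAC addrK.
have [jE|jE] : j = inZp s \/ j = inZp s.-1.
  have j3 := ltn_ord j.
  have {}jN : nat_of_ord j <> s.+1 %% 3 by move=> jE; case/eqP: jN; apply: val_inj.
  have : nat_of_ord j = s %% 3 \/ nat_of_ord j = s.-1 %% 3 by lia.
  by case=> jE; [left | right]; apply: val_inj.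
- have ys : s.-1 < s by lia.
  have /andP[] : ~~ band 1 e j (Ordinal ys) && ~~ band 1 e (j + inZp 1)%R (Ordinal ys).
    by apply: step; rewrite /= ?prednK //; lia.
  by exists (Ordinal ys).
- have ys : s.-2 < s by lia.
  have /andP[] : ~~ band 1 e j (Ordinal ys) && ~~ band 1 e (j + inZp 1)%R (Ordinal ys).
    by apply: step; rewrite /= ?prednK //; lia.
  by exists (Ordinal ys).
Qed.

(** * Edge-connectivity of the band graph and its complement *)

Section Band.

Variables (p s d e : nat).
Hypotheses (ps : p < s) (es : e < s).
Hypothesis density : 2 * (d * s + e) <= p.+1 * s.
Hypothesis large : p + s <= d * s + e.

Let colZ : injective (widen_ord ps : 'I_p.+1 -> 'I_s).
Proof. by move=> j j' /(congr1 val) /= jj'; apply: val_inj. Qed.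

Let bandE (x j : 'I_p.+1) :
  band d e x (widen_ord ps j) = ((x - j)%R < d + (j < e)).
Proof. by rewrite /band [inZp _]valZpK. Qed.

Let d_gt0 : 0 < d.
Proof.
by rewrite lt0n; apply: contraTneq large => ->; rewrite mul0n -ltnNge; lia.
Qed.

Let deg_le (y : 'I_s) : d + (y < e) <= p.+1.
Proof.
case: ltnP => ye /=.
  have : 2 * d < p.+1 by rewrite -(@ltn_pmul2r s); lia.
  lia.
have : 2 * d <= p.+1 by rewrite -(@leq_pmul2r s); lia.
lia.
Qed.

Lemma card_band_column (y : 'I_s) : #|[set x : 'I_p.+1 | band d e x y]| = d + (y < e).
Proof. exact: card_cyclic_interval. Qed.

Lemma sum_card_band : \sum_(y < s) #|[set x : 'I_p.+1 | band d e x y]| = d * s + e.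
Proof.
under eq_bigr => y _ do rewrite card_band_column.
rewrite big_split /= sum_nat_const card_ord mulnC; congr (_ + _).
rewrite (eq_bigr (fun y : 'I_s => if y < e then 1 else 0)); last first.
  by move=> y _; case: ltnP.
by rewrite -big_mkcond -(big_ord_widen s (fun=> 1) (ltnW es)) sum1_card card_ord.
Qed.

Lemma band_edge_connectivity : d <= edge_connectivity (rel_edges (@band p s d e)).
Proof.
apply: rel_edge_connectivity_lower.
- by rewrite !card_ord; lia.
- by move=> y; rewrite card_band_column leq_addr.
move=> A A0 A1; case: (ltnP 1 d) => d1.
  apply: split_by_cyclic_intervals A0 A1; [|exact: colZ|].
    by rewrite d1 (leq_trans _ (deg_le (Ordinal es))) ?leq_addr.
  by move=> x j; rewrite bandE => /leq_trans; apply; rewrite leq_addr.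
(* Now [large] says [p <= e], so every column [j < p] has length 2 and contains [j] and [j + 1];
   only the step at [p] may be missing. *)
have d1E : d = 1 by lia.
apply: (leq_trans d1); apply: (split_by_cyclic_edges (j0 := ord_max)) A0 A1 => j jmax.
have jp : j < p by rewrite ltn_neqAle -ltnS ltn_ord andbT.
exists (widen_ord ps j); rewrite bandE.
  by rewrite subrr /=; lia.
rewrite (addrC j) addrK /= modn_small; last by lia.
by move: large; rewrite d1E; case: (ltnP j e); lia.
Qed.

Lemma band_complement_edge_connectivity :
  p.+1 - (d + (0 < e)) <=
    edge_connectivity (rel_edges (fun x y => ~~ @band p s d e x y)).
Proof.
have d0p : d + (0 < e) <= p.+1 by apply: (deg_le (Ordinal (leq_ltn_trans (leq0n e) es))).
have ye (y : 'I_s) : (y < e) <= (0 < e) by case: ltnP => //; lia.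
apply: rel_edge_connectivity_lower.
- by rewrite !card_ord; lia.
- move=> y; have := cardsC [set x : 'I_p.+1 | band d e x y].
  rewrite card_band_column card_ord.
  rewrite (_ : ~: _ = [set x | ~~ band d e x y]); last by apply/setP => x; rewrite !inE.
  by have := ye y; lia.
move=> A A0 A1; set l := p.+1 - _.
have [l1|l1] := leqP l 1; last first.
  (* [c] is the maximal column length. Beyond the first [c] rows from [j - c] lies the interval of
     length [l] starting at [j], so the complement of column [j - c] contains it. *)
  pose c := inZp (d + (0 < e)) : 'I_p.+1.
  apply: (split_by_cyclic_intervals (col := fun j => widen_ord ps (j - c)%R)) A0 A1.
  - by rewrite l1 leq_subr.
  - by move=> j j' /colZ/addIr.
  move=> x j xj; rewrite bandE -leqNgt.
  have -> : (x - (j - c) = inZp (nat_of_ord (x - j)%R + (d + (0 < e))))%R.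
    by rewrite inZpD valZpK opprB addrA addrAC.
  rewrite [leqRHS]modn_small; last by lia.
  by have := ye (widen_ord ps (j - c)%R); rewrite /=; lia.
(* The complement has length at most 1 while [density] keeps columns within half of the rows. For
   [e = 0] this would leave [p = d = 1], which [large] forbids. *)
have [p2 d1] : p = 2 /\ d = 1.
  have pd : p.+1 <= d.+1 + (0 < e) by rewrite /l in l1; lia.
  move: pd; case: (posnP e) => [e0|e0] pd.
    have d2 : 2 * d <= p.+1 by rewrite -(@leq_pmul2r s); lia.
    have d1 : d = 1 by lia.
    by move: large; rewrite d1 e0; lia.
  have : 2 * d < p.+1 by rewrite -(@ltn_pmul2r s); lia.
  lia.
apply: leq_trans l1 _; rewrite d1.
by apply: split_by_band3_complement A0 A1 => //; move: large density; rewrite p2 d1; lia.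
Qed.

End Band.

(** * Extremal graphs, the upper bound and the formula for M *)

(** One vertex of Y is kept isolated; the remaining [r * (s - 1)] places suffice for [m] edges by
    the density hypothesis. *)
Lemma exists_kappa_product_eq0 (r s m : nat) : 0 < r <= s -> 2 * m <= r * s ->
  exists (V : finType) (G : bipartite_graph V),
    has_parameters r s m G /\ kappa_product G = 0.
Proof.
case: s => [|s]; first by lia.
move=> rs m_le; pose A := setX [set: 'I_r] [set~ (ord0 : 'I_s.+1)].
have : m <= #|A|.
  rewrite cardsX cardsT cardsC1 !card_ord /=.
  by case: s rs m_le {A} => [|s] rs m_le; nia.
case/card_geqP => D [uniqD sizeD subD].
pose R x y := (x, y) \in D.
have cardR : #|rel_edges R| = m.
  rewrite card_imset; last exact: rel_edge_inj.
  rewrite -sizeD -(card_uniqP uniqD); apply: eq_card => -[x y].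
  by rewrite inE.
exists ('I_r + 'I_s.+1)%type, (rel_graph R); split.
  by have := rel_graph_parameters R; rewrite !card_ord cardR.
apply/eqP; rewrite muln_eq0 -leqn0; apply/orP; left.
apply: leq_trans (edge_connectivity_degree _ _ (inr ord0)) _.
  by rewrite card_sum !card_ord; lia.
rewrite leqn0 cards_eq0; apply/eqP/setP => e; rewrite !inE; apply/andP => -[].
case/imsetP => -[x y]; rewrite inE => /subD; rewrite !inE => /= y0 ->.
by rewrite !inE /= => /eqP[yE]; rewrite yE eqxx in y0.
Qed.

Lemma kappa_product_upper (r s m : nat) (V : finType) (G : bipartite_graph V) :
  0 < r -> 0 < s -> #|V| = r + s -> has_parameters r s m G ->
  kappa_product G <= if m < (r + s).-1 then 0 else (m %/ s) * ((r * s - m) %/ s).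
Proof.
move=> r0 s0 cardV [Xr Ys Em]; have V2 : 1 < #|V| by lia.
case: ifP => [m_small|_].
  rewrite /kappa_product edge_connectivity_eq0 //.
  by apply/negP => /connected_card_edges; lia.
have := card_bc_edges G; rewrite Xr Ys Em => bcE.
apply: leq_mul; rewrite leq_divRL // mulnC.
  by have := card_ypart_edge_connectivity G V2; rewrite Ys Em.
by have := card_ypart_edge_connectivity (bipartite_complement G) V2; rewrite Ys; lia.
Qed.

Lemma exists_kappa_product_lower (r s m : nat) :
  0 < r <= s -> 2 * m <= r * s -> r + s <= m.+1 ->
  exists (V : finType) (G : bipartite_graph V),
    [/\ #|V| = r + s, has_parameters r s m G &
        (m %/ s) * ((r * s - m) %/ s) <= kappa_product G].
Proof.
case: r => [//|p] /andP[_ ps] m_le large; have s0 : 0 < s by lia.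
pose d := m %/ s; pose e := m %% s.
have mE : d * s + e = m by rewrite -divn_eq.
have es : e < s by rewrite ltn_mod.
have density : 2 * (d * s + e) <= p.+1 * s by rewrite mE.
have large' : p + s <= d * s + e by rewrite mE.
exists ('I_p.+1 + 'I_s)%type, (rel_graph (@band p s d e)); split.
- by rewrite card_sum !card_ord.
- have := rel_graph_parameters (@band p s d e).
  by rewrite !card_ord card_rel_edges sum_card_band ?mE.
apply: leq_mul; first exact: band_edge_connectivity.
rewrite /= bc_edges_rel_graph.
apply: leq_trans (band_complement_edge_connectivity ps es density large').
rewrite -{1}mE subnDA -mulnBl.
(* The floor of [(r * s - m) / s] is [r - d], lowered by one when [e > 0], which matches
   [d + (0 < e)]. *)
case: (posnP e) => [->|e0]; first by rewrite subn0 mulnK // addn0.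
rewrite addn1 -ltnS ltn_divLR //.
have : 2 * d < p.+1 by rewrite -(@ltn_pmul2r s); lia.
nia.
Qed.

Lemma M_natE (r s m : nat) : 0 < r <= s -> 2 * m <= r * s ->
  M r s (r + s) m =
  (if m < (r + s).-1 then 0 else (m %/ s) * ((r * s - m) %/ s))%N%:R%R.
Proof.
move=> /andP[r0 rs] m_le; have s0 : 0 < s by lia.
(* With [r = 1] and [m = n - 1] one would have [m = s], against [2 * m <= r * s]. *)
rewrite /M (_ : _ || _ = (m < (r + s).-1)); last by case: eqP; nia.
case: ifP => // /negbT; rewrite -leqNgt => m_ge.
have sR : (s%:R != 0 :> rat)%R by rewrite pnatr_eq0 -lt0n.
have div_r : 2 * (m %/ s) <= r.
  by rewrite -(@leq_pmul2r s) // -mulnA (leq_trans _ m_le) // leq_mul // leq_divM.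
case: (boolP (s %| m)) => [/dvdnP[q mE]|sNm] /=.
  (* For [m = q * s] the bound [n - 1 <= m] already gives [n <= m]: [q = 0] is too small, [q = 1]
     would force [r = 1] against [2 * q <= r], and [q >= 2] gives [m >= 2 * s >= n]. *)
  rewrite mE mulnK // in div_r.
  have -> : r + s <= m.
    by move: m_ge div_r; rewrite mE; case: q {mE} => [|[|q]]; [lia|lia|nia].
  by rewrite mE -mulnBl !mulnK // natrM natrM mulfK // -natrB //; lia.
(* Strictness, from the nonzero remainder, keeps [r - 1 - m %/ s] from being truncated in the
   naturals. *)
have div_r' : 2 * (m %/ s) < r.
  rewrite -(@ltn_pmul2r s) // -mulnA (leq_trans _ m_le) // ltn_mul2l /=.
  by rewrite ltn_neqAle leq_divM andbT -dvdn_eq.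
rewrite natrM; congr (_ * _)%R.
have -> : (r * s - m) %/ s = r - 1 - m %/ s.
  rewrite {1}(divn_eq m s).
  have e0 : 0 < m %% s by rewrite lt0n.
  have es : m %% s < s by rewrite ltn_mod.
  apply/eqP; rewrite eqn_leq -ltnS ltn_divLR // leq_divRL //.
  move: (m %/ s) (m %% s) div_r' e0 es => d e dr e0 es.
  have -> : r = (r - 1 - d) + d + 1 by lia.
  move: (r - 1 - d) => k; nia.
by rewrite !natrB //; lia.
Qed.

Local Open Scope ring_scope.

Theorem theorem4p2 (r s n m : nat)
    (r_ge1 : (1 <= r)%N) (r_le_s : (r <= s)%N) (n_def : n = (r + s)%N)
    (m_le : m%:R <= 1 / 2%:R * r%:R * s%:R :> rat) :
  (forall (V : finType) (G : bipartite_graph V),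
      #|V| = n -> has_parameters r s m G ->
      0 <= ((kappa_product G)%:R : rat) <= M r s n m) /\
  (exists (V : finType) (G : bipartite_graph V),
      has_parameters r s m G /\ kappa_product G = 0%N) /\
  (exists (V : finType) (G : bipartite_graph V),
      has_parameters r s m G /\ (kappa_product G)%:R = M r s n m).
Proof.
have rs : (0 < r <= s)%N by rewrite r_ge1.
have s_gt0 : (0 < s)%N by apply: leq_trans r_le_s.
have {}m_le : (2 * m <= r * s)%N.
  rewrite -(ler_nat rat) !natrM -ler_pdivlMl ?ltr0n //.
  by move: m_le; rewrite mul1r -mulrA.
rewrite {}n_def M_natE //; split; [|split].
- by move=> V G cardV paramG; rewrite ler0n ler_nat kappa_product_upper.
- exact: exists_kappa_product_eq0.
(* Below [n - 1] edges the upper bound is 0, so the graph with an isolated vertex attains it. *)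
case: ifPn => [_|].
  have [V [G [paramG kG0]]] := exists_kappa_product_eq0 rs m_le.
  by exists V, G; rewrite kG0.
move=> m_large; have large : (r + s <= m.+1)%N by lia.
have [V [G [cardV paramG lower]]] := exists_kappa_product_lower rs m_le large.
exists V, G; split=> //; congr (_%:R); apply/eqP; rewrite eqn_leq lower andbT.
by have := kappa_product_upper r_ge1 s_gt0 cardV paramG; rewrite (negPf m_large).
Qed.
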